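(* Given an integer $\mu\geq 2$, there exists an infinite $\mu$-sequence $s_0=1\leq s_1\leq s_2\leq\cdots$ such that for all $n\geq1$ $$s_n\leq 1+\sqrt{\mu-2}\,\sqrt{\mu-1+n/4}^{\,n}\,\frac{\sqrt{\pi}^{\,n}}{(n/2)!}\leq\sqrt{\mu}\,\sqrt{\mu+n/4}^{\,n}\,\frac{\sqrt{\pi}^{\,n}}{(n/2)!}.$$
   Context: For an integer $\mu\geq 2$, a $\mu$-sequence is a finite or infinite sequence $s_0=1,s_1,s_2,\dots$ of strictly positive integers such that for every $m\geq 1$ for which $s_m$ is defined, the lattice $\{(z_0,\dots,z_m)\in\mathbf{Z}^{m+1}:\sum_{k=0}^m s_kz_k=0\}$ has minimum (smallest squared Euclidean norm of a nonzero vector) at least $\mu$. $x!=\Gamma(x+1)$. *)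

(* Defs.v *)
From HB Require Import structures.
From mathcomp Require Import all_boot all_order all_algebra.
From mathcomp Require Import all_classical all_reals all_analysis.

Set Implicit Arguments.
Unset Strict Implicit.
Unset Printing Implicit Defensive.

Import Order.TTheory GRing.Theory Num.Theory.

Local Open Scope classical_set_scope.
Local Open Scope ring_scope.

Definition sqnorm (n : nat) (z : 'rV[int]_n) : int := \sum_(k < n) z 0 k ^+ 2.

Definition orth_lattice (s : nat -> int) (m : nat) : set 'rV[int]_m.+1 :=
  [set z | \sum_(k < m.+1) s k * z 0 k = 0].

Definition is_lattice_min (n : nat) (L : set 'rV[int]_n) (d : int) : Prop :=
  (exists z, [/\ L z, z != 0 & sqnorm z = d]) /\
  (forall z, L z -> z != 0 -> d <= sqnorm z).

(* Infinite sequences only; the finite ones are their initial segments, with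
   the condition restricted to the available indices m. *)
Definition mu_sequence (mu : int) (s : nat -> int) : Prop :=
  [/\ s 0%N = 1,
      forall m : nat, 0 < s m
    & forall m : nat, (1 <= m)%N ->
        exists2 d : int, is_lattice_min (@orth_lattice s m) d & mu <= d].

(* Real-valued Lebesgue integral, hence meaningful only where it converges,
   i.e. for 0 < x. *)
Definition Gamma (R : realType) (x : R) : R :=
  \int[lebesgue_measure]_(t in `]0, +oo[) (t `^ (x - 1) * expR (- t)).

Definition real_fact (R : realType) (x : R) : R := Gamma (x + 1).

(* Main.v *)
Require Import Defs.
From HB Require Import structures.
From mathcomp Require Import all_boot all_order all_algebra.
From mathcomp Require Import all_classical all_reals all_analysis.
From mathcomp Require Import measurable_realfun.
From mathcomp Require Import ring lra zify.

(* Choose s_n greedily, as the least positive integer that creates no lattice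
   vector of squared norm < mu. A forbidden value of s_n is determined by the last
   coordinate c > 0 of such a vector, with c^2 <= mu - 2, and by its first n
   coordinates, an integer point z of the ball |z|^2 <= mu - 2 with
   <s, z> = - c s_n < 0; by the symmetry z |-> - z at most half of the integer
   points of the ball qualify. The forbidden values only increase with n, hence so
   does s_n.

   It remains to see that the ball |z|^2 <= r contains at most
   2 V_n (r + 1 + n/4)^(n/2) integer points, V_n = sqrt(pi)^n / (n/2)! being the
   volume of the unit ball. This is a crude direct count for n = 1, 2 and goes on
   by induction, slicing along a coordinate: by convexity of t |-> t^(n/2) for n >= 2, the sum over a in Z of
   (x - a^2)_+^(n/2) is at most the integral of (x + 1/4 - t^2)_+^(n/2), which is
   V_(n+1) / V_n (x + 1/4)^((n+1)/2). *)

Set Implicit Arguments.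
Unset Strict Implicit.
Unset Printing Implicit Defensive.

Import Order.TTheory GRing.Theory Num.Theory.
Import numFieldNormedType.Exports.

Local Open Scope classical_set_scope.
Local Open Scope ring_scope.

(** * The factorial at half-integers *)

Section GammaHalf.
Context {R : realType}.
Implicit Types (F : R -> R) (l : R) (n : nat).

(** The bound exp x >= 1 + x^(n+1) / (n+1)! squeezes the expression between 0 and (n+1)! / x. *)
Lemma expR_exp_cvgy0 n : (x : R) ^+ n * expR (- x) @[x --> +oo] --> (0 : R).
Proof.
have H : (n.+1)`!%:R * x^-1 @[x --> +oo] --> (0 : R).
  rewrite -[X in _ --> X](mulr0 (n.+1)`!%:R).
  apply: cvgM; first exact: cvg_cst.
  by apply/gtr0_cvgV0; [near=> x; near: x; exact: nbhs_pinfty_gt | exact: cvg_id].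
apply: (squeeze_cvgr _ (cvg_cst 0) H); near=> x.
have x0 : 0 < x by near: x; exact: nbhs_pinfty_gt.
rewrite mulr_ge0 ?exprn_ge0 ?expR_ge0 ?(ltW x0)//=.
rewrite expRN ler_pdivrMr ?expR_gt0// mulrAC ler_pdivlMr// -exprSr.
rewrite -ler_pdivrMl ?ltr0n ?fact_gt0// mulrC.
by apply: le_trans (expR_ge1Dxn n (ltW x0)); rewrite lerDr.
Unshelve. all: by end_near. Qed.

Lemma sqrt_exp_expR_cvgy0 n :
  Num.sqrt (x : R) ^+ n * expR (- x) @[x --> +oo] --> (0 : R).
Proof.
apply: (squeeze_cvgr _ (cvg_cst 0) (expR_exp_cvgy0 n)); near=> x.
have x1 : 1 <= x by near: x; exact: nbhs_pinfty_ge.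
rewrite mulr_ge0 ?exprn_ge0 ?expR_ge0 ?sqrtr_ge0//=.
have x0 : 0 <= x by exact: le_trans ler01 x1.
rewrite ler_pM2r ?expR_gt0// lerXn2r ?nnegrE ?sqrtr_ge0//.
by rewrite -[X in _ <= X](sqr_sqrtr x0) expr2 ler_peMl ?sqrtr_ge0// -sqrtr1 ler_wsqrtr.
Unshelve. all: by end_near. Qed.

Lemma continuous_sqrt_exp_expR n :
  continuous (fun x : R => Num.sqrt x ^+ n * expR (- x)).
Proof.
move=> x; apply: cvgM.
  apply: (@continuous_comp _ _ _ Num.sqrt (fun y => y ^+ n)).
    exact: sqrt_continuous.
  exact: exprn_continuous.
apply: (@continuous_comp _ _ _ -%R expR); first exact: opp_continuous.
exact: continuous_expR.
Qed.

(* [F] is a primitive of the integrand of Gamma (n / 2 + 1), with limit [l] at +oo. *)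
Definition is_gamma_primitive (n : nat) (F : R -> R) (l : R) :=
  [/\ F 0 = 0, F x @[x --> 0^'+] --> F 0, F x @[x --> +oo] --> l
    & forall x : R, 0 < x -> is_derive x 1 F (Num.sqrt x ^+ n * expR (- x))].

Lemma gamma_primitive_real_fact n F l :
  is_gamma_primitive n F l -> real_fact (n%:R / 2) = l.
Proof.
move=> [F0 Fr Fy dF]; rewrite /real_fact /Gamma.
rewrite (@eq_Rintegral _ _ R lebesgue_measure _
    (fun t => Num.sqrt t ^+ n * expR (- t))); last first.
  move=> t; rewrite inE/= in_itv/= andbT => t0.
  by rewrite addrK [n%:R / 2]mulrC powRrM powR12_sqrt ?(ltW t0)// powR_mulrn ?sqrtr_ge0.
(* In the form [Num.sqrt t ^+ n * expR (- t)] the integrand is continuous at 0 too, so the interval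
   may be closed there. *)
rewrite /Rintegral integral_itv_obnd_cbnd; last first.
  apply/measurable_EFinP; apply: measurable_funTS.
  apply: continuous_measurable_fun; exact: continuous_sqrt_exp_expR.
rewrite (@ge0_continuous_FTC2y _ _ F _ l) ?F0 ?sube0//.
- exact/continuous_subspaceT/continuous_sqrt_exp_expR.
- by move=> x x0; have [] := dF x x0.
- by rewrite F0 in Fr.
- by move=> x; rewrite in_itv/= andbT => x0; rewrite derive1E; have [] := dF x x0.
Qed.

(** The quotient [Num.sqrt x ^+ n / Num.sqrt x] stands for x^((n-1)/2), in a form that also covers n
    = 0. *)
Lemma is_derive_sqrt_exp_expR n (x : R) : 0 < x ->
  is_derive x 1 (fun y : R => Num.sqrt y ^+ n.+1 * expR (- y))
    (n.+1%:R / 2 * (Num.sqrt x ^+ n / Num.sqrt x * expR (- x)) -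
     Num.sqrt x ^+ n.+1 * expR (- x)).
Proof.
move=> x0.
have H1 := @is_deriveX _ _ _ n.+1 x 1 _ (is_derive1_sqrt x0).
have H2 := @is_derive1_comp R expR -%R x _ _ (is_derive_expR _) (is_deriveNid x 1).
have := @is_deriveM _ _ _ _ _ _ _ _ H1 H2.
set D := (X in is_derive _ _ _ X -> _) => H.
have DE : D = (n.+1%:R / 2 * (Num.sqrt x ^+ n / Num.sqrt x * expR (- x)) -
     Num.sqrt x ^+ n.+1 * expR (- x)).
  rewrite /D /GRing.scale/= !fctE /=.
  by field; rewrite sqrtr_eq0 -ltNge.
rewrite -DE; move: H; congr (is_derive _ _ _ _).
by apply/funext => y/=; rewrite !fctE.
Qed.

Lemma cvg_sqrt_exp_expR_at0 n :
  Num.sqrt (x : R) ^+ n.+1 * expR (- x) @[x --> 0^'+] --> (0 : R).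
Proof.
apply: cvg_at_right_filter.
have := @continuous_sqrt_exp_expR n.+1 0.
by rewrite /continuous_at sqrtr0 expr0n/= mul0r.
Qed.

Lemma gamma_primitive0 : is_gamma_primitive 0 (fun x : R => 1 - expR (- x)) 1.
Proof.
split.
- by rewrite oppr0 expR0 subrr.
- apply: cvg_at_right_filter; apply: cvgB; first exact: cvg_cst.
  apply: (@continuous_comp _ _ _ -%R expR); first exact: opp_continuous.
  exact: continuous_expR.
- rewrite -[X in _ --> X]subr0; apply: cvgB; first exact: cvg_cst.
  exact: cvgr_expR.
- move=> x _; rewrite expr0 mul1r.
  have H := @is_derive1_comp R expR -%R x _ _ (is_derive_expR _) (is_deriveNid x 1).
  have := is_deriveB (is_derive_cst (1 : R) x 1) H.
  by rewrite mulrN1 sub0r opprK.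
Qed.

(* The primitive is [F x = E (sqrt x) - sqrt x * exp (- x)], [E] being the
   primitive of the Gaussian vanishing at 0. *)
Lemma gamma_primitive1 : exists F,
  is_gamma_primitive 1 F (Num.sqrt pi / 2).
Proof.
pose E := @gauss_integral_proof.integral0_gauss R.
have E0 : E 0 = 0.
  by rewrite /E /gauss_integral_proof.integral0_gauss set_itv1 Rintegral_set1.
have int01 : (@lebesgue_measure R).-integrable `[0, 1] (EFin \o gauss_fun).
  apply: continuous_compact_integrable => //; first exact: segment_compact.
  by apply: continuous_subspaceT; exact: continuous_gauss_fun.
have Er : E x @[x --> 0^'+] --> (0 : R).
  have := @parameterized_integral_continuous R 0 1 gauss_fun ler01 int01.
  move/(continuous_within_itvP _ ltr01) => [_ + _].
  by rewrite /parameterized_integral set_itv1 Rintegral_set1.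
have Ey : E x @[x --> +oo] --> Num.sqrt pi / 2.
  (* The known limit pi / 4 is that of the square of [E]; as [E] is nonnegative, a square root
     recovers its own limit. *)
  have : Num.sqrt (E x ^+ 2) @[x --> +oo] --> Num.sqrt (pi / 4).
    apply: continuous_cvg => //; first exact: sqrt_continuous.
    exact: gauss_integral_proof.cvg_integral0_gauss_sqr.
  rewrite sqrtrM ?pi_ge0// sqrtrV// (_ : 4 = 2 ^+ 2); last by rewrite expr2 -natrM.
  rewrite sqrtr_sqr ger0_norm//.
  rewrite (_ : (fun _ => Num.sqrt _) = E)//.
  apply/funext => r; rewrite sqrtr_sqr// ger0_norm//.
  exact: gauss_integral_proof.integral0_gauss_ge0.
have dE (x : R) : 0 < x -> is_derive x 1 E (gauss_fun x).
  move=> x0.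
  have int : (@lebesgue_measure R).-integrable `[0, x + 1] (EFin \o gauss_fun).
    apply: continuous_compact_integrable => //; first exact: segment_compact.
    by apply: continuous_subspaceT; exact: continuous_gauss_fun.
  have xx1 : x < x + 1 by rewrite ltrDl.
  have [dF vF] := continuous_FTC1_closed xx1 int x0 (@continuous_gauss_fun R x).
  by split; [exact: dF|rewrite -derive1E; exact: vF].
exists (fun x => E (Num.sqrt x) - Num.sqrt x ^+ 1 * expR (- x)); split.
- by rewrite sqrtr0 E0 expr1 mul0r subr0.
- rewrite sqrtr0 E0 expr1 mul0r; apply: cvgB; last exact: cvg_sqrt_exp_expR_at0.
  apply: (@cvg_comp _ _ _ Num.sqrt E _ (0^'+)); last exact: Er.
  move=> A [e/= e0 HA]; near=> x; apply: HA.
    rewrite /= sub0r normrN ger0_norm ?sqrtr_ge0// -(ger0_norm (ltW e0)) -sqrtr_sqr.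
    rewrite ltr_sqrt ?exprn_gt0//; near: x; apply: nbhs_right_lt.
    exact: exprn_gt0.
  by rewrite sqrtr_gt0.
- rewrite -[X in _ --> X]subr0; apply: cvgB; last exact: sqrt_exp_expR_cvgy0.
  apply: (@cvg_comp _ _ _ Num.sqrt E _ (+oo)); last exact: Ey.
  apply/cvgryPge => A; near=> x.
  have Ax : A ^+ 2 <= x by near: x; apply: nbhs_pinfty_ge; rewrite num_real.
  by rewrite (le_trans (ler_norm A))// -sqrtr_sqr ler_wsqrtr.
- move=> x x0.
  have sx : Num.sqrt x != 0 by rewrite sqrtr_eq0 -ltNge.
  have H1 := @is_derive1_comp R E Num.sqrt x _ _ (dE _ _) (is_derive1_sqrt x0).
  have := is_deriveB (H1 _) (is_derive_sqrt_exp_expR 0 x0).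
  rewrite /gauss_fun sqr_sqrtr ?(ltW x0)// => /(_ _)/is_derive_eq; apply.
    by rewrite sqrtr_gt0.
  by field.
Unshelve. all: by end_near. Qed.

(** Integration by parts: the boundary term vanishes at 0 and at +oo, which leaves Gamma (n/2 + 2) =
    (n/2 + 1) Gamma (n/2 + 1). *)
Lemma gamma_primitiveSS n F l : is_gamma_primitive n F l ->
  is_gamma_primitive n.+2
    (fun x => n.+2%:R / 2 * F x - Num.sqrt x ^+ n.+2 * expR (- x))
    (n.+2%:R / 2 * l).
Proof.
move=> [F0 Fr Fy dF]; split.
- by rewrite F0 mulr0 sqrtr0 expr0n mul0r subr0.
- rewrite sqrtr0 expr0n/= mul0r; apply: cvgB; last exact: cvg_sqrt_exp_expR_at0.
  by apply: cvgM => //; exact: cvg_cst.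
- rewrite -[X in _ --> X]subr0; apply: cvgB; last exact: sqrt_exp_expR_cvgy0.
  by apply: cvgM => //; exact: cvg_cst.
- move=> x x0.
  have sx : Num.sqrt x != 0 by rewrite sqrtr_eq0 -ltNge.
  have := is_deriveB (is_deriveZ (n.+2%:R / 2) (dF x x0))
    (is_derive_sqrt_exp_expR n.+1 x0).
  move/is_derive_eq; apply.
  by rewrite -[(n.+2%:R / 2) *: _]/(_ * _) (exprSr _ n) mulfK// opprB addrCA mulrA subrr addr0.
Qed.

Lemma real_fact_half0 : real_fact (0%:R / 2 : R) = 1.
Proof. exact: gamma_primitive_real_fact gamma_primitive0. Qed.

Lemma real_fact_half1 : real_fact (1%:R / 2 : R) = Num.sqrt pi / 2.
Proof. by have [F /gamma_primitive_real_fact] := gamma_primitive1. Qed.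

Lemma real_fact_halfSS n :
  real_fact (n.+2%:R / 2 : R) = n.+2%:R / 2 * real_fact (n%:R / 2).
Proof.
suff [F [l HF]] : exists F l, is_gamma_primitive n F l.
  by rewrite (gamma_primitive_real_fact (gamma_primitiveSS HF))
             (gamma_primitive_real_fact HF).
elim/ltn_ind: n => -[|[|n]] IH.
- by do 2!eexists; exact: gamma_primitive0.
- by have [F] := gamma_primitive1; do 2!eexists; eassumption.
- have [//|F [l HF]] := IH n; do 2!eexists; exact: gamma_primitiveSS HF.
Qed.

End GammaHalf.

(** * Volume of the unit ball *)

Section MeanValue.
Context {R : realType}.
Implicit Types (f df : R -> R).

(** The left alternative covers a = b, where no intermediate point exists. *)
Lemma MVT_is_derive f df (a b : R) : a <= b ->
  (forall x, a <= x <= b -> is_derive x 1 f (df x)) ->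
  f b = f a \/ exists2 c, a < c < b & f b - f a = df c * (b - a).
Proof.
rewrite le_eqVlt => /predU1P[-> _|ab dfx]; first by left.
have dfo x : x \in `]a, b[%R -> is_derive x 1 f (df x).
  by rewrite in_itv/= => /andP[ax xb]; apply: dfx; rewrite !ltW.
have cf : {within `[a, b], continuous f}.
  apply: derivable_within_continuous => x; rewrite in_itv/= => abx.
  by have [] := dfx x abx.
by right; have [c] := MVT ab dfo cf; rewrite in_itv; exists c.
Qed.

Lemma is_derive_ge0_le f df (a b : R) : a <= b ->
  (forall x, a <= x <= b -> is_derive x 1 f (df x)) ->
  (forall x, a < x < b -> 0 <= df x) -> f a <= f b.
Proof.
move=> ab dfx df0; have [->//|[c abc fE]] := MVT_is_derive ab dfx.
by rewrite -subr_ge0 fE mulr_ge0 ?df0// subr_ge0.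
Qed.

Lemma is_derive_0_eq f df (a b : R) : a <= b ->
  (forall x, a <= x <= b -> is_derive x 1 f (df x)) ->
  (forall x, a < x < b -> df x = 0) -> f a = f b.
Proof.
move=> ab dfx df0; have [->//|[c abc /eqP]] := MVT_is_derive ab dfx.
by rewrite df0// mul0r subr_eq0 => /eqP.
Qed.

Lemma continuous_primitive f (a b : R) : continuous f ->
  exists F : R -> R, forall x, a < x < b -> is_derive x 1 F (f x).
Proof.
move=> cf; exists (fun x => \int[lebesgue_measure]_(t in `[a, x]) f t).
move=> x /andP[ax xb].
have int : (@lebesgue_measure R).-integrable `[a, b] (EFin \o f).
  apply: continuous_compact_integrable => //; first exact: segment_compact.
  exact: continuous_subspaceT.
have [dF vF] := continuous_FTC1_closed xb int ax (cf x).
by split; [exact: dF|rewrite -derive1E; exact: vF].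
Qed.

End MeanValue.

Section BallVolume.
Context {R : realType}.
Implicit Type n : nat.

Definition ball_volume n : R := Num.sqrt pi ^+ n / real_fact (n%:R / 2).

Lemma ball_volume0 : ball_volume 0 = 1.
Proof. by rewrite /ball_volume real_fact_half0 expr0 invr1 mulr1. Qed.

Lemma ball_volume1 : ball_volume 1 = 2.
Proof.
have s0 : Num.sqrt (pi : R) != 0 by rewrite sqrtr_eq0 -ltNge pi_gt0.
by rewrite /ball_volume real_fact_half1 expr1; field.
Qed.

Lemma ball_volumeSS n : ball_volume n.+2 = 2 * pi / n.+2%:R * ball_volume n.
Proof.
rewrite /ball_volume real_fact_halfSS !exprS mulrA -expr2 sqr_sqrtr ?pi_ge0//.
by rewrite !invfM invrK; ring.
Qed.

Lemma ball_volume2 : ball_volume 2 = pi.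
Proof. by rewrite ball_volumeSS ball_volume0 mulr1 mulrAC divff ?mul1r. Qed.

Lemma ball_volume_gt0 n : 0 < ball_volume n.
Proof.
elim/ltn_ind: n => -[|[|n]] IH; rewrite ?ball_volume0 ?ball_volume1//.
by rewrite ball_volumeSS mulr_gt0 ?IH// divr_gt0// mulr_gt0// pi_gt0.
Qed.

(** The function vanishes at -pi/2 and pi/2, so this derivative encodes the Wallis reduction (n + 2)
    W_(n+2) = (n + 1) W_n, W_k being the integral of cos^k between these points. *)
Lemma is_derive_cos_exp_sin n (x : R) :
  is_derive x 1 (fun y : R => cos y ^+ n.+1 * sin y)
    (n.+2%:R * cos x ^+ n.+2 - n.+1%:R * cos x ^+ n).
Proof.
have H1 := @is_deriveX _ _ _ n.+1 x 1 _ (is_derive_cos x).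
have := @is_deriveM _ _ _ _ _ _ _ _ H1 (is_derive_sin x).
set D := (X in is_derive _ _ _ X -> _) => H.
have <- : D = n.+2%:R * cos x ^+ n.+2 - n.+1%:R * cos x ^+ n.
  rewrite /D -[_ *: cos x]/(_ * _) -[_ *: - sin x]/(_ * _) -[sin x *: _]/(_ * _) !fctE/=.
  have := cos2Dsin2 x => /(canRL (addKr _)) s2.
  have -> : cos x ^+ n.+1 * cos x + sin x * (n.+1%:R * cos x ^+ n * - sin x) =
    cos x ^+ n.+1 * cos x - n.+1%:R * cos x ^+ n * sin x ^+ 2 by ring.
  by rewrite s2 !exprS; ring.
move: H; congr (is_derive _ _ _ _).
by apply/funext => y/=; rewrite !fctE.
Qed.

(** V_(n+1) / V_n is the integral of cos^(n+1) over [-pi/2, pi/2]: when n grows by 2, both are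
    multiplied by (n + 2) / (n + 3), by [ball_volumeSS] and by the Wallis reduction. A primitive [C]
    expresses the integral, so that a later substitution amounts to a differentiation. *)
Lemma ball_volumeS_cos n : exists2 C : R -> R,
  (forall x : R, is_derive x 1 C (cos x ^+ n.+1)) &
  ball_volume n.+1 = ball_volume n * (C (pi / 2) - C (- (pi / 2))).
Proof.
elim/ltn_ind: n => -[|[|n]] IH.
- exists sin => [x|]; first exact: is_derive_sin.
  by rewrite ball_volume0 ball_volume1 sinN sin_pihalf; ring.
- exists (fun x => 2^-1 * (cos x ^+ 1 * sin x + x)) => [x|].
    have := is_deriveZ 2^-1 (is_deriveD (is_derive_cos_exp_sin 0 x) (is_derive_id x 1)).
    move/is_derive_eq; apply.
    by rewrite -[_ *: _]/(_ * _); field.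
  by rewrite ball_volume1 ball_volume2 cosN sinN cos_pihalf sin_pihalf; field.
- have [//|C dC VC] := IH n.
  exists (fun x => n.+3%:R^-1 * (cos x ^+ n.+2 * sin x + n.+2%:R * C x)) => [x|].
    have := is_deriveZ n.+3%:R^-1
      (is_deriveD (is_derive_cos_exp_sin n.+1 x) (is_deriveZ n.+2%:R (dC x))).
    move/is_derive_eq; apply.
    rewrite -[n.+2%:R *: _]/(_ * _) subrK -[_ *: _]/(_ * _) mulKf//.
  rewrite (ball_volumeSS n.+1) (ball_volumeSS n) VC cosN sinN cos_pihalf sin_pihalf.
  by rewrite expr0n/= !mul0r !add0r; field; rewrite -!natrD !pnatr_eq0.
Qed.

End BallVolume.

(** * Sums over Z of powers of sqrt (a - z^2) *)

Section LatticeSum.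
Context {R : realType}.
Implicit Type n : nat.

(** Power mean inequality between the exponents 2 and n + 2. The induction goes from k to k + 2:
    multiply by the hypothesis and apply the Chebyshev inequality (a^2 + b^2) (a^k + b^k) <= 2
    (a^(k+2) + b^(k+2)). *)
Lemma power_mean_exp n (a b c : R) : 0 <= a -> 0 <= b -> 0 <= c ->
  2 * c ^+ 2 <= a ^+ 2 + b ^+ 2 -> 2 * c ^+ n.+2 <= a ^+ n.+2 + b ^+ n.+2.
Proof.
move=> a0 b0 c0 abc; elim/ltn_ind: n => -[|[|n]] IH //.
(* The graph of t^(3/2) lies above its tangent at t = c^2; here t = x^2. *)
- have tangent (x : R) : 0 <= x -> 3 * (c * x ^+ 2) <= 2 * x ^+ 3 + c ^+ 3.
    move=> x0; rewrite -subr_ge0.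
    have -> : 2 * x ^+ 3 + c ^+ 3 - 3 * (c * x ^+ 2) = (x - c) ^+ 2 * (2 * x + c) by ring.
    by rewrite mulr_ge0 ?sqr_ge0// addr_ge0// mulr_ge0.
  have Ta := tangent a a0; have Tb := tangent b b0.
  have := ler_wpM2l c0 abc; rewrite mulrDr mulrCA -exprS; lra.
- have {}IH := IH n (leqnSn _).
  have cheb : 0 <= (a ^+ 2 - b ^+ 2) * (a ^+ n.+2 - b ^+ n.+2).
    have [ab|/ltW ba] := leP a b.
      by rewrite mulr_le0// subr_le0 lerXn2r.
    by rewrite mulr_ge0// subr_ge0 lerXn2r.
  have : 2 * c ^+ 2 * (2 * c ^+ n.+2) <=
         (a ^+ 2 + b ^+ 2) * (a ^+ n.+2 + b ^+ n.+2).
    by rewrite ler_pM// mulr_ge0// exprn_ge0.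
  rewrite 2!(exprS _ n.+3) 2!(exprS _ n.+2) [b ^+ n.+4]exprS (exprS b n.+2).
  by rewrite !expr2 in cheb *; lra.
Qed.

Lemma le_sqr_sqrt (x : R) : x <= Num.sqrt x ^+ 2.
Proof.
have [x0|x0] := leP 0 x; first by rewrite sqr_sqrtr.
by rewrite (le_trans (ltW x0))// sqr_ge0.
Qed.

(** As [Num.sqrt] is 0 on negative reals, this is midpoint convexity, combined with monotonicity, of
    the truncated power t_+^(n/2 + 1). *)
Lemma sqrt_exp_midpoint n (a b c : R) : 2 * c <= a + b ->
  2 * Num.sqrt c ^+ n.+2 <= Num.sqrt a ^+ n.+2 + Num.sqrt b ^+ n.+2.
Proof.
move=> abc; apply: power_mean_exp; rewrite ?sqrtr_ge0//.
have [c0|c0] := leP 0 c.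
  by rewrite sqr_sqrtr// (le_trans abc)// lerD// le_sqr_sqrt.
by rewrite (ltr0_sqrtr c0) expr0n mulr0 addr_ge0// sqr_ge0.
Qed.

Lemma continuous_ball_section n (a : R) :
  continuous (fun x : R => Num.sqrt (a - x ^+ 2) ^+ n).
Proof.
move=> x; apply: (@continuous_comp _ _ _ (fun y : R => Num.sqrt (a - y ^+ 2)) (fun y : R => y ^+ n)).
  apply: (@continuous_comp _ _ _ (fun y : R => a - y ^+ 2) Num.sqrt).
    by apply: cvgB; [exact: cvg_cst|exact: exprn_continuous].
  exact: sqrt_continuous.
exact: exprn_continuous.
Qed.

(* The mean of [(z + u) ^+ 2] and [(z - u) ^+ 2] is at most [z ^+ 2 + 1 / 4] for
   [u <= 1 / 2], and [t |-> sqrt t ^+ n] is convex and nondecreasing for [2 <= n]. *)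
Lemma unit_cell_bound n (a z M : R) (F : R -> R) :
  (forall x : R, - M < x < M ->
    is_derive x 1 F (Num.sqrt (a + 4^-1 - x ^+ 2) ^+ n.+2)) ->
  `|z| + 2^-1 < M ->
  Num.sqrt (a - z ^+ 2) ^+ n.+2 <= F (z + 2^-1) - F (z - 2^-1).
Proof.
move=> dF zM.
have [zM1 zM2] : z + 2^-1 < M /\ - M < z - 2^-1.
  by move: (ler_norm z) (ler_norm (- z)); rewrite normrN; split; lra.
pose K := Num.sqrt (a - z ^+ 2) ^+ n.+2.
(* [h] vanishes at 0, its value at 1/2 is the difference of the two sides, and [dh] is its
   derivative. *)
pose h u := F (z + u) - F (z - u) - 2 * K * u.
pose dh u := Num.sqrt (a + 4^-1 - (z + u) ^+ 2) ^+ n.+2 +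
  Num.sqrt (a + 4^-1 - (z - u) ^+ 2) ^+ n.+2 - 2 * K.
have half0 : 0 <= 2^-1 :> R by rewrite invr_ge0.
suff : h 0 <= h 2^-1.
  rewrite /h !addr0 !subr0 subrr mulr0 subr0 subr_ge0 mulrAC divff ?mul1r//.
apply: (@is_derive_ge0_le R h dh) => // u /andP[u0 u1].
  have d1 : is_derive u 1 (fun v : R => z + v) 1.
    by have := is_deriveD (is_derive_cst z u 1) (is_derive_id u 1); rewrite add0r.
  have d2 : is_derive u 1 (fun v : R => z - v) (- 1).
    by have := is_deriveB (is_derive_cst z u 1) (is_derive_id u 1); rewrite sub0r.
  have i1 : - M < z + u < M by apply/andP; split; lra.
  have i2 : - M < z - u < M by apply/andP; split; lra.
  have D1 := @is_derive1_comp R F (fun v => z + v) u _ _ (dF _ i1) d1.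
  have D2 := @is_derive1_comp R F (fun v => z - v) u _ _ (dF _ i2) d2.
  have D3 := is_deriveZ (2 * K) (is_derive_id u 1).
  have := is_deriveB (is_deriveB D1 D2) D3.
  move/is_derive_eq; apply.
  by rewrite -[_ *: _]/(_ * _) /dh; ring.
rewrite subr_ge0; apply: sqrt_exp_midpoint.
(* The shift by 1/4 absorbs u^2, the excess of the mean of the two squares over z^2. *)
have : u ^+ 2 <= 2^-1 ^+ 2 by rewrite lerXn2r ?nnegrE// ltW.
rewrite !expr2; lra.
Qed.

(* Substituting [x = r * sin u] turns the integral of [sqrt (r ^+ 2 - x ^+ 2) ^+ n]
   over [-r, r] into that of [r ^+ n.+1 * cos u ^+ n.+1] over [-pi / 2, pi / 2]. *)
Lemma sqrt_section_primitive n (r M : R) (F : R -> R) : 0 < r -> r < M ->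
  (forall x : R, - M < x < M -> is_derive x 1 F (Num.sqrt (r ^+ 2 - x ^+ 2) ^+ n)) ->
  ball_volume n * (F r - F (- r)) = ball_volume n.+1 * r ^+ n.+1.
Proof.
move=> r0 rM dF; have [C dC ->] := @ball_volumeS_cos R n.
suff -> : F r - F (- r) = r ^+ n.+1 * (C (pi / 2) - C (- (pi / 2))) by ring.
pose h u := F (r * sin u) - r ^+ n.+1 * C u.
pose dh u := Num.sqrt (r ^+ 2 - (r * sin u) ^+ 2) ^+ n * (r * cos u)
  - r ^+ n.+1 * cos u ^+ n.+1.
suff : h (- (pi / 2)) = h (pi / 2).
  rewrite /h sinN sin_pihalf mulrN mulr1; lra.
have pi0 := @pi_gt0 R.
apply: (@is_derive_0_eq R h dh) => [|u _|u /andP[u0 u1]]; first by lra.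
  have rs : - M < r * sin u < M.
    rewrite -ltr_norml normrM (gtr0_norm r0) (le_lt_trans _ rM)//.
    by rewrite ler_piMr ?(ltW r0)// sin_max.
  have d1 : is_derive u 1 (fun v : R => r * sin v) (r * cos u) :=
    is_deriveZ r (is_derive_sin u).
  have := is_deriveB (@is_derive1_comp R F (fun v => r * sin v) u _ _ (dF _ rs) d1)
     (is_deriveZ (r ^+ n.+1) (dC u)).
  move/is_derive_eq; apply.
  by rewrite /dh.
have cos0 : 0 <= cos u by apply: cos_ge0_pihalf; rewrite !ltW.
rewrite /dh; have -> : r ^+ 2 - (r * sin u) ^+ 2 = (r * cos u) ^+ 2.
  by rewrite !exprMn -{1}[r ^+ 2]mulr1 -(cos2Dsin2 u); ring.
rewrite sqrtr_sqr ger0_norm ?mulr_ge0 ?(ltW r0)//.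
by rewrite -exprSr exprMn subrr.
Qed.

(** The cells [z - 1/2, z + 1/2] with |z| <= k tile [-k - 1/2, k + 1/2]. The integrand is
    nonnegative and vanishes outside [-r, r], so for every k the integral over the tiled interval is
    at most the one over [-r, r]. *)
Lemma sum_unit_cells n (a : R) k : 0 <= a ->
  ball_volume n.+2 * \sum_(i < k.*2.+1) Num.sqrt (a - (i%:R - k%:R) ^+ 2) ^+ n.+2
  <= ball_volume n.+3 * Num.sqrt (a + 4^-1) ^+ n.+3.
Proof.
move=> a0; pose r := Num.sqrt (a + 4^-1); pose M := r + k%:R + 1.
have r0 : 0 < r by rewrite sqrtr_gt0; lra.
have r2 : a + 4^-1 = r ^+ 2 by rewrite sqr_sqrtr//; lra.
have k0 : 0 <= k%:R :> R by [].
have [F dF] := continuous_primitive (- M) M (@continuous_ball_section n.+2 (a + 4^-1)).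
pose G i := F (i%:R - k%:R - 2^-1).
have sumF : \sum_(i < k.*2.+1) Num.sqrt (a - (i%:R - k%:R) ^+ 2) ^+ n.+2 <=
    F (k%:R + 2^-1) - F (- (k%:R + 2^-1)).
  have -> : F (k%:R + 2^-1) - F (- (k%:R + 2^-1)) =
      \sum_(i < k.*2.+1) (G i.+1 - G i).
    rewrite -(big_mkord xpredT (fun i => G i.+1 - G i)) telescope_sumr// /G.
    have -> : k.*2.+1%:R = k%:R + k%:R + 1 :> R by rewrite -addn1 -addnn !natrD.
    by congr (F _ - F _); lra.
  apply: ler_sum => i _; rewrite /G.
  have -> : i.+1%:R - k%:R - 2^-1 = i%:R - k%:R + 2^-1 :> R.
    by rewrite -addn1 natrD; lra.
  apply: (@unit_cell_bound n a _ M) => //.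
  have ik : `|i%:R - k%:R| <= k%:R :> R.
    have : i%:R <= k%:R + k%:R :> R by rewrite -natrD addnn ler_nat -ltnS.
    have : 0 <= i%:R :> R by [].
    by rewrite ler_norml => ? ?; apply/andP; split; lra.
  rewrite /M; lra.
have rM : r < M by rewrite /M; lra.
have Fr x : r <= x -> x < M -> F x = F r.
  move=> rx xM; symmetry.
  apply: (@is_derive_0_eq R F (fun x => Num.sqrt (a + 4^-1 - x ^+ 2) ^+ n.+2)) => //.
    by move=> y /andP[y1 y2]; apply: dF; apply/andP; split; lra.
  move=> y /andP[y1 y2]; rewrite r2 ler0_sqrtr ?expr0n// subr_le0.
  by rewrite lerXn2r ?nnegrE; lra.
have FNr x : x <= - r -> - M < x -> F x = F (- r).
  move=> rx xM.
  apply: (@is_derive_0_eq R F (fun x => Num.sqrt (a + 4^-1 - x ^+ 2) ^+ n.+2)) => //.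
    by move=> y /andP[y1 y2]; apply: dF; apply/andP; split; lra.
  move=> y /andP[y1 y2]; rewrite r2 ler0_sqrtr ?expr0n// subr_le0 -(sqrrN y).
  by rewrite lerXn2r ?nnegrE; lra.
have Fle x y : - M < x -> x <= y -> y < M -> F x <= F y.
  move=> Mx xy yM.
  apply: (@is_derive_ge0_le R F (fun x => Num.sqrt (a + 4^-1 - x ^+ 2) ^+ n.+2)) => //.
  by move=> u /andP[u1 u2]; apply: dF; apply/andP; split; lra.
rewrite r2 in dF; rewrite -/r -(sqrt_section_primitive r0 rM dF).
rewrite ler_wpM2l ?(ltW (ball_volume_gt0 _))//; apply: (le_trans sumF).
(* Either the tiled interval lies inside [-r, r] and [F] is monotone, or it sticks out on both
   sides, where [F] is constant. *)
have [kr|rk] := leP (k%:R + 2^-1) r.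
  by rewrite lerB// Fle//; rewrite /M; lra.
rewrite (Fr (k%:R + 2^-1)) ?(FNr (- (k%:R + 2^-1)))//; rewrite /M; lra.
Qed.

End LatticeSum.

(** * Integer points of balls and the greedy sequence *)

Section IntegerPoints.

Definition isqrt (r : nat) : nat := \max_(i < r.+1 | (i ^ 2 <= r)%N) i.

Lemma isqrt_sqr_le r : (isqrt r ^ 2 <= r)%N.
Proof.
rewrite /isqrt; elim/big_ind: _ => // x y xr yr.
by rewrite /maxn; case: ifP.
Qed.

Lemma leq_isqrt a r : (a <= isqrt r)%N = (a ^ 2 <= r)%N.
Proof.
apply/idP/idP => [ar|ar].
  by apply: leq_trans (isqrt_sqr_le r); rewrite leq_exp2r.
have ar1 : (a < r.+1)%N by move: ar; rewrite -mulnn; nia.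
exact: (@leq_bigmax_cond _ (fun i : 'I_r.+1 => (i ^ 2 <= r)%N) (fun i => i : nat) (Ordinal ar1)).
Qed.

Definition sym_range (k : nat) : seq int := [seq i%:Z - k%:Z | i <- iota 0 k.*2.+1].

Lemma mem_sym_range k a : (a \in sym_range k) = (`|a| <= k)%N.
Proof.
apply/mapP/idP => [[i]|ak]; first by rewrite mem_iota => /andP[_ ik] ->; lia.
by exists `|(a + k%:Z)%R|%N; [rewrite mem_iota|]; lia.
Qed.

Lemma uniq_sym_range k : uniq (sym_range k).
Proof. by rewrite map_inj_uniq ?iota_uniq// => i j; lia. Qed.

(** * Enumeration of the integer points of a ball *)

Definition sum_sqr (z : seq int) : nat := \sum_(a <- z) `|a| ^ 2.

(** Slicing along the first coordinate; the truncated subtraction is exact because a^2 <= r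
    throughout the range of [a]. *)
Fixpoint ball_points (n r : nat) : seq (seq int) :=
  if n is n'.+1 then
    [seq a :: z | a <- sym_range (isqrt r), z <- ball_points n' (r - `|a| ^ 2)]
  else [:: [::]].

Lemma ball_pointsS n r : ball_points n.+1 r =
  [seq a :: z | a <- sym_range (isqrt r), z <- ball_points n (r - `|a| ^ 2)].
Proof. by []. Qed.

Lemma mem_ball_points n r z :
  (z \in ball_points n r) = (size z == n) && (sum_sqr z <= r)%N.
Proof.
elim: n r z => [|n IH] r z; last rewrite ball_pointsS.
  by case: z => [|a z]; rewrite inE// /sum_sqr big_nil.
apply/allpairsPdep/idP => [[a [y [+ + ->]]]|].
  rewrite mem_sym_range leq_isqrt IH /= eqSS => ar /andP[-> yr].
  by rewrite /sum_sqr big_cons -leq_subRL.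
case: z => [//|a z]/=; rewrite eqSS /sum_sqr big_cons => /andP[zn azr].
have ar : (`|a| ^ 2 <= r)%N by apply: leq_trans azr; rewrite leq_addr.
exists a, z; split => //; first by rewrite mem_sym_range leq_isqrt.
by rewrite IH zn leq_subRL.
Qed.

Lemma uniq_ball_points n r : uniq (ball_points n r).
Proof.
elim: n r => [//|n IH] r; rewrite ball_pointsS; apply: allpairs_uniq_dep => //.
  exact: uniq_sym_range.
by move=> [a y] [b z] _ _ /= [-> ->].
Qed.

Lemma size_ball_pointsS n r : size (ball_points n.+1 r) =
  (\sum_(i < (isqrt r).*2.+1)
     size (ball_points n (r - `|i%:Z - (isqrt r)%:Z| ^ 2)))%N.
Proof.
rewrite ball_pointsS size_allpairs_dep sumnE big_map big_map.
by rewrite -(big_mkord xpredT (fun i => size (ball_points n (r - `|i%:Z - (isqrt r)%:Z| ^ 2)))) /index_iota subn0.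
Qed.

Lemma size_ball_points1 r : size (ball_points 1 r) = (isqrt r).*2.+1.
Proof. by rewrite size_ball_pointsS sum_nat_const card_ord muln1. Qed.

(** Count the enclosing square: with k = [isqrt r], (2 k + 1)^2 <= 6 k^2 + 3, the difference being 2
    (k - 1)^2. *)
Lemma size_ball_points2 r : (size (ball_points 2 r) <= 6 * r + 3)%N.
Proof.
rewrite size_ball_pointsS; apply: (@leq_trans ((isqrt r).*2.+1 * (isqrt r).*2.+1)).
  rewrite -[X in (_ <= X * _)%N]card_ord -sum_nat_const; apply: leq_sum => i _.
  rewrite size_ball_points1 ltnS leq_double leq_isqrt.
  by apply: leq_trans (isqrt_sqr_le _) _; rewrite leq_subr.
have := isqrt_sqr_le r; rewrite -muln2; nia.
Qed.

(** * Central symmetry and the values to avoid *)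

Definition dot (l z : seq int) : int := \sum_(i < size l) l`_i * z`_i.

Lemma dotN l z : dot l (map -%R z) = - dot l z.
Proof.
rewrite /dot -sumrN; apply: eq_bigr => i _.
have [iz|zi] := ltnP i (size z); first by rewrite (nth_map 0)// mulrN.
by rewrite [z`_i]nth_default// [(map _ _)`_i]nth_default ?size_map// mulr0 oppr0.
Qed.

Lemma sum_sqrN z : sum_sqr (map -%R z) = sum_sqr z.
Proof. by rewrite /sum_sqr big_map; apply: eq_bigr => a _; rewrite abszN. Qed.

Lemma half_ball_points l n r :
  (2 * count (fun z => dot l z < 0)%R (ball_points n r) <= size (ball_points n r))%N.
Proof.
set B := ball_points n r.
have negpos : (count (fun z => dot l z < 0)%R B <= count (fun z => 0 < dot l z)%R B)%N.
  rewrite -2!size_filter -(size_map (map -%R)).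
  apply: uniq_leq_size.
    rewrite map_inj_uniq ?filter_uniq ?uniq_ball_points//.
    exact: (inj_map oppr_inj).
  move=> y /mapP[z]; rewrite !mem_filter => /andP[z0 zB] ->.
  rewrite dotN oppr_gt0 z0 /=; move: zB.
  by rewrite /B !mem_ball_points size_map sum_sqrN.
apply: (@leq_trans (count (fun z => dot l z < 0)%R B + count (fun z => 0 < dot l z)%R B)).
  by rewrite mul2n -addnn leq_add2l.
rewrite -count_predUI (_ : count (predI _ _) B = 0)%N ?addn0 ?count_size//.
apply/eqP; rewrite -leqn0 leqNgt -has_count; apply/hasPn => z _ /=.
by case: ltgtP.
Qed.

(* Contains every value of the next term that creates a lattice vector of squared
   norm at most [r.+1] with last coordinate [c > 0]; the quotients that are not
   exact are harmless, as only an upper bound on the number of values matters. *)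
Definition excluded (l : seq int) (r : nat) : seq int :=
  [seq (- dot l z %/ c%:Z)%Z |
    c <- iota 1 (isqrt r), z <- [seq z <- ball_points (size l) r | dot l z < 0]].

Lemma size_excluded l r :
  (2 * size (excluded l r) <= isqrt r * size (ball_points (size l) r))%N.
Proof.
by rewrite size_allpairs size_iota mulnCA leq_mul2l size_filter half_ball_points orbT.
Qed.

Lemma excludedP l r z c : size z = size l -> (sum_sqr z <= r)%N ->
  (0 < c)%N -> (c ^ 2 <= r)%N -> dot l z < 0 ->
  (- dot l z %/ c%:Z)%Z \in excluded l r.
Proof.
move=> zl zr c0 cr lz; apply/allpairsP; exists (c, z) => /=; split => //.
  by rewrite mem_iota c0 add1n ltnS leq_isqrt.
by rewrite mem_filter lz mem_ball_points zl eqxx.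
Qed.

Lemma dot_rcons0 l x z : size z = size l -> dot (rcons l x) (rcons z 0) = dot l z.
Proof.
move=> zl; rewrite /dot size_rcons big_ord_recr/= -zl !nth_rcons ltnn eqxx mulr0 addr0.
by apply: eq_bigr => i _; rewrite !nth_rcons -zl ltn_ord.
Qed.

(** A zero coordinate is appended to the witness. This inclusion is what makes the greedy sequence
    nondecreasing. *)
Lemma excluded_rcons l x r : {subset excluded l r <= excluded (rcons l x) r}.
Proof.
move=> a /allpairsP[[c z]/=]; rewrite mem_iota mem_filter mem_ball_points.
move=> [/andP[c0 cr] /and3P[lz /eqP zl zr] ->].
rewrite -(dot_rcons0 x zl) excludedP ?size_rcons ?zl// ?dot_rcons0//.
  by rewrite /sum_sqr -cats1 big_cat/= big_seq1 addn0.
by rewrite -leq_isqrt -ltnS -add1n.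
Qed.

(** Pigeonhole: the integers from 1 to [(size B).+1] cannot all lie in [B]. *)
Lemma exists_not_excluded (B : seq int) :
  exists m, [&& (0 < m)%N, m%:Z \notin B & (m <= (size B).+1)%N].
Proof.
apply: contrapT => noex.
have /uniq_leq_size : uniq [seq m%:Z | m <- iota 1 (size B).+1].
  by rewrite map_inj_uniq ?iota_uniq// => i j; lia.
move=> /(_ B); rewrite size_map size_iota ltnn => H; suff: false by [].
apply: H => _ /mapP[m + ->]; rewrite mem_iota add1n ltnS => /andP[m0 mB].
by apply/negPn/negP => mNB; apply: noex; exists m; rewrite m0 mNB.
Qed.

Lemma exists_next l r : exists m, (0 < m)%N && (m%:Z \notin excluded l r).
Proof.
by have [m /and3P[m0 mB _]] := exists_not_excluded (excluded l r); exists m; rewrite m0.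
Qed.

Definition next_term r l : int := (ex_minn (exists_next l r))%:Z.

Lemma next_term_gt0 r l : 0 < next_term r l.
Proof. by rewrite /next_term; case: ex_minnP => m /andP[]. Qed.

Lemma next_term_notin r l : next_term r l \notin excluded l r.
Proof. by rewrite /next_term; case: ex_minnP => m /andP[]. Qed.

Lemma next_term_le r l : next_term r l <= (size (excluded l r)).+1%:Z.
Proof.
rewrite /next_term; case: ex_minnP => m _ minm.
have [p /and3P[p0 pB ple]] := exists_not_excluded (excluded l r).
by rewrite lez_nat (leq_trans _ ple)// minm// p0.
Qed.

Lemma next_term_rcons r l x : next_term r l <= next_term r (rcons l x).
Proof.
rewrite /next_term; case: ex_minnP => m _ minm; case: ex_minnP => p /andP[p0 pB] _.
by rewrite lez_nat minm// p0 (contra _ pB)//; exact: excluded_rcons.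
Qed.

(** * The greedy sequence *)

Fixpoint greedy_prefix r n : seq int :=
  if n is n'.+1 then rcons (greedy_prefix r n') (next_term r (greedy_prefix r n'))
  else [::].

Definition greedy r n : int := next_term r (greedy_prefix r n).

Lemma greedy_prefixE r n : greedy_prefix r n = mkseq (greedy r) n.
Proof. by elim: n => [//|n IH]; rewrite mkseqS -IH. Qed.

(** Over the empty prefix every product is 0, never negative, so nothing is excluded and the least
    candidate is 1. *)
Lemma greedy0 r : greedy r 0 = 1.
Proof.
apply: le_anti; rewrite -gtz0_ge1 next_term_gt0 andbT.
rewrite (le_trans (next_term_le _ _))// lez_nat ltnS.
rewrite size_allpairs size_filter/= /dot big_ord0 ltxx muln0//.
Qed.

Lemma greedy_le r n : greedy r n <= greedy r n.+1.
Proof. exact: next_term_rcons. Qed.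

Lemma sqr_absz (a : int) : (`|a| ^ 2)%N%:Z = a ^+ 2.
Proof. by rewrite -abszX; lia. Qed.

Lemma greedy_orthogonal r n (z : nat -> int) :
  \sum_(k < n) greedy r k * z k = 0 ->
  (\sum_(k < n) `|z k| ^ 2 <= r.+1)%N -> forall k, (k < n)%N -> z k = 0.
Proof.
elim: n => [//|n IH]; rewrite !big_ord_recr/= => sz zr k.
have [zn0|zn0] := eqVneq (z n) 0.
  rewrite ltnS leq_eqVlt => /predU1P[->//|]; apply: IH.
    by move: sz; rewrite zn0 mulr0 addr0.
  by rewrite (leq_trans _ zr)// leq_addr.
(* Up to a change of sign of the whole vector, the last coordinate is positive. *)
suff main (y : nat -> int) : 0 < y n ->
    \sum_(k < n) greedy r k * y k + greedy r n * y n = 0 ->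
    (\sum_(k < n) `|y k| ^ 2 + `|y n| ^ 2 <= r.+1)%N -> False.
  move: zn0; rewrite neq_lt => /orP[zn0|zn0]; exfalso; last exact: (main z).
  apply: (main (fun k => - z k)); rewrite ?oppr_gt0//.
    under eq_bigr do rewrite mulrN.
    by rewrite sumrN mulrN -opprD sz oppr0.
  by under eq_bigr do rewrite abszN; rewrite abszN.
move=> {sz zr zn0 k} yn0 sy yr.
pose l := greedy_prefix r n; pose w := mkseq y n.
have lE : l = mkseq (greedy r) n := greedy_prefixE r n.
have szl : size l = n by rewrite lE size_mkseq.
have dotE : dot l w = \sum_(k < n) greedy r k * y k.
  by rewrite /dot szl; apply: eq_bigr => i _; rewrite lE !nth_mkseq.
have sqE : sum_sqr w = (\sum_(k < n) `|y k| ^ 2)%N.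
  by rewrite /sum_sqr big_map -(big_mkord xpredT (fun k => `|y k| ^ 2)%N) /index_iota subn0.
have dotyn : - dot l w = greedy r n * y n.
  by apply/eqP; rewrite eq_sym -subr_eq0 opprK addrC dotE sy.
have dot0 : dot l w < 0 by rewrite -oppr_gt0 dotyn mulr_gt0// next_term_gt0.
(* Both [w] and the last coordinate are nonzero, so each takes at least 1 of the total r + 1. This
   leaves at most r for the other, as membership in [excluded] requires. *)
have sq0 : (0 < sum_sqr w)%N.
  rewrite lt0n; apply/eqP; rewrite sqE => /eqP.
  rewrite sum_nat_eq0 => /forallP y0; move: dot0; rewrite dotE big1 ?ltxx// => i _.
  by have := y0 i; rewrite expn_eq0 absz_eq0 andbT => /eqP ->; rewrite mulr0.
have yn1 : (0 < `|y n|)%N by rewrite absz_gt0 gt_eqF.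
have yn2 : (0 < `|y n| ^ 2)%N by rewrite expn_gt0 yn1.
rewrite -sqE in yr.
have := @excludedP l r w `|y n|%N; rewrite size_mkseq dotyn szl.
rewrite gez0_abs ?(ltW yn0)// mulzK ?gt_eqF// => H.
have := next_term_notin r l; rewrite -/(greedy r n) H//.
- by lia.
- by lia.
Qed.

End IntegerPoints.

(** * Bounds *)

Section Counting.
Context {R : realType}.
Implicit Type n r : nat.

Lemma sin_le (x : R) : 0 <= x -> sin x <= x.
Proof.
move=> x0.
have := @is_derive_ge0_le R (fun y : R => y - sin y) (fun y : R => 1 - cos y) 0 x x0.
rewrite sin0 subr0 subr_ge0; apply.
by move=> y _; have := is_deriveB (is_derive_id y 1) (is_derive_sin y).
Qed.

(* s = sin (pi / 6) is the root 1/2 of 4 s^3 - 3 s + 1 = (s + 1) (2 s - 1)^2. *)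
Lemma pi_ge3 : 3 <= pi :> R.
Proof.
pose s : R := sin (pi / 6).
have pi0 := @pi_gt0 R.
have s0 : 0 <= s by apply: sin_ge0_pi; apply/andP; split; lra.
have c2 := cos2Dsin2 (pi / 6 : R).
have trip : 3 * s - 4 * s ^+ 3 = 1.
  rewrite -[RHS]sin_pihalf (_ : pi / 2 = pi / 6 + (pi / 6 + pi / 6)); last by field.
  rewrite !(sinD, cosD) -/s.
  set c := cos _ in c2 *; have -> : c * c = 1 - s ^+ 2 by rewrite -c2 -/s; ring.
  have -> : s * (1 - s ^+ 2 - s * s) + c * (s * c + c * s) =
    s * (1 - s ^+ 2 - s * s) + 2 * s * c ^+ 2 by ring.
  have -> : c ^+ 2 = 1 - s ^+ 2 by rewrite -c2 -/s; ring.
  by ring.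
have /eqP : (s + 1) * (2 * s - 1) ^+ 2 = 0.
  by transitivity (1 - (3 * s - 4 * s ^+ 3)); [ring|rewrite trip subrr].
have s1 : s + 1 != 0 by rewrite gt_eqF//; lra.
rewrite mulf_eq0 (negbTE s1) sqrf_eq0 => /eqP s12.
have : s <= pi / 6 by apply: sin_le; lra.
lra.
Qed.

Lemma size_ball_points_le n r :
  (size (ball_points n.+1 r))%:R <= 2 * ball_volume n.+1 *
    Num.sqrt (r%:R + 1 + n.+1%:R / 4 : R) ^+ n.+1.
Proof.
elim: n r => [|[|n] IH] r.
- rewrite size_ball_points1 expr1 ball_volume1.
  set k := isqrt r; have k2 : k%:R ^+ 2 <= r%:R :> R.
    by rewrite -natrX ler_nat isqrt_sqr_le.
  have r0 : 0 <= r%:R :> R by [].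
  set q := Num.sqrt _.
  have q0 : 0 <= q by exact: sqrtr_ge0.
  have q2 : q ^+ 2 = r%:R + 1 + 1 / 4 by rewrite sqr_sqrtr//; lra.
  have kq : k%:R <= q by rewrite -ler_sqr ?nnegrE// q2; lra.
  have q1 : 1 <= q by rewrite -ler_sqr ?nnegrE// q2 expr1n; lra.
  by rewrite -addn1 -addnn !natrD; lra.
(* Dimension 2: since pi >= 3, the right side is at least 6 (r + 3/2), which exceeds 6 r + 3. *)
- have r0 : 0 <= r%:R :> R by [].
  rewrite sqr_sqrtr; last by lra.
  rewrite ball_volume2; apply: (@le_trans _ _ (6 * r + 3)%:R).
    by rewrite ler_nat size_ball_points2.
  have pi3 := pi_ge3.
  have : 3 * (r%:R + 1 + 2%:R / 4) <= pi * (r%:R + 1 + 2%:R / 4) :> R.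
    by rewrite ler_wpM2r//; lra.
  by rewrite natrD natrM; lra.
- set a : R := r%:R + 1 + n.+2%:R / 4.
  have a0 : 0 <= a by rewrite /a !addr_ge0.
  have -> : r%:R + 1 + n.+3%:R / 4 = a + 4^-1.
    by rewrite /a -[n.+3]addn1 natrD; field.
  (* The slicing costs a shift of 1/4, which turns [n.+2%:R / 4] into [n.+3%:R / 4]; the factor 2 is
     carried along unchanged. *)
  rewrite -mulrA; apply: le_trans (ler_wpM2l _ (sum_unit_cells n (isqrt r) a0)) => //.
  rewrite size_ball_pointsS natr_sum mulrA mulr_sumr; apply: ler_sum => i _.
  apply: le_trans (IH _) _.
  have ir : (`|i%:Z - (isqrt r)%:Z| ^ 2 <= r)%N.
    by rewrite -leq_isqrt; have := ltn_ord i; lia.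
  rewrite natrB//.
  have -> : (`|i%:Z - (isqrt r)%:Z| ^ 2)%N%:R = (i%:R - (isqrt r)%:R) ^+ 2 :> R.
    by rewrite -[LHS]/((_%:Z)%:~R) sqr_absz rmorphXn/= rmorphB.
  by rewrite (_ : r%:R - _ + 1 + _ = a - (i%:R - (isqrt r)%:R) ^+ 2)// /a; ring.
Qed.

(** Makes room for the summand 1 in the final comparison. Raising the dimension by 2 multiplies the
    right side by at least 2 pi w / (n + 3), where w = u + (n + 3) / 4; this is at least 1 because 4
    w >= n + 3. *)
Lemma sqrt_le_ball_volume n (u : R) : 2 <= u ->
  Num.sqrt u <= ball_volume n.+1 * Num.sqrt (u + n.+1%:R / 4) ^+ n.+1.
Proof.
move=> u2; elim/ltn_ind: n => -[|[|n]] IH.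
- rewrite ball_volume1 expr1.
  have : Num.sqrt u <= Num.sqrt (u + 1 / 4) by rewrite ler_wsqrtr//; lra.
  have := sqrtr_ge0 u; lra.
- rewrite ball_volume2 sqr_sqrtr; last by lra.
  have pi3 := pi_ge3.
  have : 3 * (u + 2%:R / 4) <= pi * (u + 2%:R / 4) :> R.
    by rewrite ler_wpM2r//; lra.
  have : Num.sqrt u <= u.
    rewrite -[leRHS]sqr_sqrtr; last by lra.
    rewrite expr2 ler_peMr ?sqrtr_ge0// -sqrtr1 ler_wsqrtr//; lra.
  lra.
- have {}IH := IH n (leqnSn _).
  have n0 : 0 <= n.+1%:R :> R by [].
  have n30 : 0 < n.+3%:R :> R by [].
  have n3 : n.+3%:R = n.+1%:R + 2 :> R by rewrite -[n.+3]addn2 natrD.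
  set v := u + n.+1%:R / 4 in IH.
  have vw : v <= u + n.+3%:R / 4 by rewrite /v n3; lra.
  apply: (le_trans IH); set w := u + _ in vw *.
  have w0 : 0 <= w by rewrite (le_trans _ vw)// /v; lra.
  rewrite ball_volumeSS (_ : _ * _ * _ = (2 * pi / n.+3%:R * w) *
    (ball_volume n.+1 * Num.sqrt w ^+ n.+1)); last first.
    by rewrite (exprS _ n.+2) (exprS _ n.+1) -[X in _ = (_ * X) * _](sqr_sqrtr w0); ring.
  have V0 := ltW (@ball_volume_gt0 R n.+1).
  apply: (@le_trans _ _ (ball_volume n.+1 * Num.sqrt w ^+ n.+1)).
    by rewrite ler_wpM2l// lerXn2r ?nnegrE ?sqrtr_ge0// ler_wsqrtr.
  have Vw : 0 <= ball_volume n.+1 * Num.sqrt w ^+ n.+1.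
    by apply: mulr_ge0 => //; apply: exprn_ge0; exact: sqrtr_ge0.
  rewrite ler_peMl//.
  rewrite mulrAC ler_pdivlMr// mul1r.
  have pi3 := pi_ge3.
  have : 3 * w <= pi * w by rewrite ler_wpM2r.
  have : n.+3%:R <= 4 * w by rewrite /w; lra.
  lra.
Qed.

End Counting.

(** * Lattice minima and the final estimates *)

Lemma orth_lattice_has_min (s : nat -> int) (m : nat) (d : int) :
  (0 < m)%N -> s 0 != 0 ->
  (forall z, @orth_lattice s m z -> z != 0 -> d <= sqnorm z) ->
  exists2 e, is_lattice_min (@orth_lattice s m) e & d <= e.
Proof.
case: m => // m _ s0 dmin.
have sq0 n (z : 'rV[int]_n) : 0 <= sqnorm z by rewrite sumr_ge0// => i _; rewrite sqr_ge0.
pose P e := `[< exists z : 'rV[int]_m.+2, [/\ @orth_lattice s m.+1 z, z != 0 & sqnorm z = e%:Z] >].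
(* The vector (s_1, -s_0, 0, ..., 0) is orthogonal to [s] and nonzero; the squared norms, being
   natural numbers, then have a least value. *)
have exP : exists e, P e.
  pose z : 'rV[int]_m.+2 := \row_i (if i == 0 then s 1%N else if i == 1 then - s 0%N else 0).
  exists `|sqnorm z|%N; apply/asboolP; exists z; split.
  - rewrite /orth_lattice/= 2!big_ord_recl big1 => [|i _]; rewrite !mxE/=; last exact: mulr0.
    by ring.
  - apply/eqP => /rowP/(_ 1); rewrite !mxE/= => /eqP; rewrite oppr_eq0 => /eqP s00.
    by rewrite s00 eqxx in s0.
  - by rewrite gez0_abs.
case: (ex_minnP exP) => e /asboolP[z [Lz z0 ze]] mine; exists e%:Z.
  split; first by exists z.
  move=> y Ly y0; rewrite -[leRHS]gez0_abs// lez_nat; apply: mine.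
  by apply/asboolP; exists y; split => //; rewrite gez0_abs.
by rewrite -ze; exact: dmin.
Qed.

Lemma greedy_mu_sequence r : mu_sequence (r.+2)%:Z (greedy r).
Proof.
split; first exact: greedy0.
  by move=> m; exact: next_term_gt0.
move=> m m1; apply: orth_lattice_has_min => //; first by rewrite greedy0.
move=> z Lz z0; rewrite leNgt; apply/negP => zr; move/negP: z0; apply; apply/eqP.
pose y k : int := z 0 (inord k).
have yE (k : 'I_m.+1) : y k = z 0 k by rewrite /y inord_val.
apply/rowP => k; rewrite mxE -yE; apply: (@greedy_orthogonal r m.+1 y) => //.
  by rewrite -[RHS]Lz; apply: eq_bigr => i _; rewrite yE.
rewrite -ltnS -ltz_nat; move: zr; rewrite /sqnorm => /le_lt_trans; apply.
rewrite -[leLHS]natz natr_sum; apply: ler_sum => i _.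
by rewrite natz sqr_absz yE.
Qed.

(** The term is at most 1 plus the number of excluded values; the half gained by symmetry in
    [size_excluded] cancels the factor 2 of [size_ball_points_le]. *)
Lemma greedy_bound (R : realType) r n : (0 < n)%N ->
  (greedy r n)%:~R <= 1 + Num.sqrt r%:R *
    (Num.sqrt (r%:R + 1 + n%:R / 4) ^+ n * ball_volume n) :> R.
Proof.
case: n => // n _.
have szp : size (greedy_prefix r n.+1) = n.+1 by rewrite greedy_prefixE size_mkseq.
have := next_term_le r (greedy_prefix r n.+1); rewrite -/(greedy r n.+1).
have := size_excluded (greedy_prefix r n.+1) r; rewrite szp.
set e := size _; set b := size _ => eb.
rewrite -(ler_int R) => /le_trans; apply.
rewrite -pmulrn -addn1 natrD addrC lerD2l.
rewrite -(@ler_pM2l _ 2)// -natrM; apply: (@le_trans _ _ (isqrt r * b)%:R).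
  by rewrite ler_nat.
rewrite natrM [leRHS]mulrCA ler_pM//.
  rewrite -ler_sqr ?nnegrE ?sqrtr_ge0// sqr_sqrtr//.
  by rewrite -natrX ler_nat isqrt_sqr_le.
by rewrite [_ ^+ _ * _]mulrC mulrA size_ball_points_le.
Qed.

(** With a = sqrt u and b = sqrt (u - 2), from y <= x and a <= x follows a x - b y >= (a - b) x >=
    (a - b) a. The last product is at least 1, since 2 (a - b) a = (a - b)^2 + a^2 - b^2 and a^2 -
    b^2 = 2. *)
Lemma bound_simplification (R : realType) (u : R) n : 2 <= u -> (0 < n)%N ->
  1 + Num.sqrt (u - 2) * (Num.sqrt (u - 1 + n%:R / 4) ^+ n * ball_volume n) <=
  Num.sqrt u * (Num.sqrt (u + n%:R / 4) ^+ n * ball_volume n).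
Proof.
case: n => // n u2 _.
have n0 : 0 <= n.+1%:R :> R by [].
set x := Num.sqrt (u + _) ^+ _ * _; set y := Num.sqrt (u - 1 + _) ^+ _ * _.
have yx : y <= x.
  rewrite ler_wpM2r ?(ltW (ball_volume_gt0 _))//.
  by rewrite lerXn2r ?nnegrE ?sqrtr_ge0// ler_wsqrtr//; lra.
have ax : Num.sqrt u <= x by rewrite /x mulrC sqrt_le_ball_volume.
have a2 : Num.sqrt u ^+ 2 = u by rewrite sqr_sqrtr//; lra.
have b2 : Num.sqrt (u - 2) ^+ 2 = u - 2 by rewrite sqr_sqrtr//; lra.
have b0 := sqrtr_ge0 (u - 2).
have ba : Num.sqrt (u - 2) <= Num.sqrt u by rewrite ler_wsqrtr//; lra.
set a := Num.sqrt u in ax a2 ba *; set b := Num.sqrt _ in b2 b0 ba *.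
have by_ : b * y <= b * x by rewrite ler_wpM2l.
have abx : (a - b) * a <= (a - b) * x by rewrite ler_wpM2l// subr_ge0.
have : 0 <= (a - b) ^+ 2 by rewrite sqr_ge0.
have : (a - b) ^+ 2 = 2 * ((a - b) * a) - 2 by rewrite -[in RHS](subrK u 2) -{2}a2; nra.
nra.
Qed.

Theorem theorem5 (R : realType) (mu : int) (hmu : 2 <= mu) :
  exists s : nat -> int,
    [/\ mu_sequence mu s,
        forall n : nat, s n <= s n.+1
      & forall n : nat, (1 <= n)%N ->
          let A : R :=
            1 + Num.sqrt (mu%:~R - 2) * Num.sqrt (mu%:~R - 1 + n%:R / 4) ^+ n
                * (Num.sqrt pi ^+ n / real_fact (n%:R / 2)) in
          let B : R :=
            Num.sqrt mu%:~R * Num.sqrt (mu%:~R + n%:R / 4) ^+ n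
            * (Num.sqrt pi ^+ n / real_fact (n%:R / 2)) in
          (s n)%:~R <= A /\ A <= B].
Proof.
have [r muE] : exists r : nat, mu = r.+2%:Z.
  by exists `|mu - 2|%N; lia.
have u2 : 2 <= mu%:~R :> R by rewrite -[2]/(2%:~R) ler_int.
have rE : r%:R = mu%:~R - 2 :> R by rewrite muE -pmulrn -[r.+2]addn2 natrD addrK.
exists (greedy r); split; first by rewrite muE; exact: greedy_mu_sequence.
  exact: greedy_le.
move=> n n1 A B; rewrite /A /B -!mulrA; split; last exact: bound_simplification.
have := greedy_bound R r n1; rewrite rE.
by have -> : mu%:~R - 2 + 1 = mu%:~R - 1 :> R by ring.
Qed.
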